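(* (a) $\Gamma$ has non-linear $5$-cliques if and only if $q=2^n$ with $n$ odd. (b) If $n$ is odd, every non-linear $5$-clique of $\Gamma$ is contained in a $6$-clique of $\Gamma$. (c) $\Gamma$ has no non-linear $k$-cliques with $k>6$.
   Context: Let $q=2^n$ and let $Q_0\cong Q(4,q)$ be the parabolic quadric generalized quadrangle in $\mathrm{PG}(4,q)$. An elliptic ovoid of $Q_0$ is a set $X=S\cap Q_0$ where $S$ is a $3$-dimensional projective subspace meeting $Q_0$ in an elliptic quadric $Q^-(3,q)$. Two distinct elliptic ovoids meet in one point (then they are tangent) or in a conic. A rosette based at $p\in Q_0$ is a set of $q$ elliptic ovoids pairwise meeting exactly in $\{p\}$. $\Gamma$ is the graph whose vertices are the elliptic ovoids of $Q_0$, adjacent iff distinct and tangent. A clique of $\Gamma$ is linear if contained in a rosette, non-linear otherwise; a $k$-clique has $k$ vertices. *)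

(* Defs.v *)
From HB Require Import structures.
From mathcomp Require Import all_boot all_order all_algebra all_field.
Set Implicit Arguments. Unset Strict Implicit. Unset Printing Implicit Defensive.
Import GRing.Theory.
Local Open Scope ring_scope.

Section Geom.
Variable F : finFieldType.

Notation vec := 'rV[F]_5.

(* A projective point of PG(4,F) is represented by its unique normalized
   coordinate vector: nonzero with first nonzero coordinate equal to 1. *)
Definition pnorm (v : vec) : bool :=
  [exists i : 'I_5, (v ord0 i == 1) &&
     [forall j : 'I_5, (j < i)%N ==> (v ord0 j == 0)]].

(* Standard parabolic quadratic form  x0^2 + x1 x2 + x3 x4  defining Q(4,q). *)
Definition Qf (v : vec) : F :=
  v ord0 (inord 0) ^+ 2 + v ord0 (inord 1) * v ord0 (inord 2)
  + v ord0 (inord 3) * v ord0 (inord 4).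

Definition bf (x y : vec) : F := Qf (x + y) - Qf x - Qf y.

Definition dotv (a v : vec) : F := \sum_(i < 5) a ord0 i * v ord0 i.

Definition Q0 : {set vec} := [set v | pnorm v & Qf v == 0].

(* The 3-space S = {a . x = 0} meets Q_0 in an elliptic quadric Q^-(3,q):
   the restriction of Qf to S is a non-singular quadratic form
   (no nonzero singular vector of S lies in the radical of the polar form on S)
   and S contains no line of Q_0 (no two linearly independent vectors x,y of S
   spanning a totally singular 2-space). *)
Definition elliptic_section (a : vec) : Prop :=
  a != 0 /\
  (forall x : vec, dotv a x = 0 -> x != 0 -> Qf x = 0 ->
      exists y : vec, dotv a y = 0 /\ bf x y != 0) /\
  (forall x y : vec, dotv a x = 0 -> dotv a y = 0 ->
      Qf x = 0 -> Qf y = 0 -> bf x y = 0 ->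
      x = 0 \/ exists c : F, y = c *: x).

Definition elliptic_ovoid (X : {set vec}) : Prop :=
  exists a : vec, elliptic_section a /\ X = [set v in Q0 | dotv a v == 0].

Definition adjG (X Y : {set vec}) : Prop := X != Y /\ #|X :&: Y| = 1%N.

Definition cliqueG (C : {set {set vec}}) : Prop :=
  (forall X, X \in C -> elliptic_ovoid X) /\
  (forall X Y, X \in C -> Y \in C -> X != Y -> adjG X Y).

Definition rosette (p : vec) (R : {set {set vec}}) : Prop :=
  p \in Q0 /\ #|R| = #|F| /\
  (forall X, X \in R -> elliptic_ovoid X) /\
  (forall X Y, X \in R -> Y \in R -> X != Y -> X :&: Y = [set p]).

Definition linear_clique (C : {set {set vec}}) : Prop :=
  cliqueG C /\ exists p R, rosette p R /\ C \subset R.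

Definition nonlinear_clique (C : {set {set vec}}) : Prop :=
  cliqueG C /\ ~ linear_clique C.

End Geom.

(* Main.v *)
Require Import Defs.
From HB Require Import structures.
From mathcomp Require Import all_boot all_order all_algebra all_field.
From mathcomp Require Import ring.

(* A hyperplane meeting Q(4,q) in an elliptic quadric misses the nucleus, so it
   has a unique equation [a] with first coordinate 1.  If [d] lies on it, then
   [a + dual d], with [dual d . x = bf d x], is another such equation, and the
   two ovoids are tangent iff [d] is singular; [a + dual d] and [a + dual e] are
   then tangent iff [bf d e] is 0 or 1, where 0 means that [d] and [e] are
   proportional.  Hence the non-linear cliques through a given ovoid are the sets
   of singular vectors with all mutual products equal to 1.  Four such vectors
   form a basis of the section on which the form is the elementary symmetric
   polynomial e_2; this is elliptic iff X^2 + X + 1 has no root in F, i.e. iff n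
   is odd, and their sum is then the only vector that can be added. *)

Set Implicit Arguments. Unset Strict Implicit. Unset Printing Implicit Defensive.
Import GRing.Theory.

Section Coordinates.
Local Open Scope ring_scope.
Variable F : finFieldType.
Notation vec := 'rV[F]_5.
Implicit Types (x y z a d : vec) (c t : F).

Local Notation "x @[ k ]" := (x ord0 (inord k : 'I_5)) (at level 2).

(** * Coordinates, linear forms and normalized vectors *)

Definition row5 (s : seq F) : vec := \row_(i < 5) s`_i.

Lemma row5E s k : (k < 5)%N -> (row5 s)@[k] = s`_k.
Proof. by move=> lt_k5; rewrite mxE inordK. Qed.

Lemma row5P x y :
  x@[0] = y@[0] -> x@[1] = y@[1] -> x@[2] = y@[2] ->
  x@[3] = y@[3] -> x@[4] = y@[4] -> x = y.
Proof.
move=> e0 e1 e2 e3 e4; apply/rowP=> i; rewrite -[i]inord_val.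
by case: i => [[|[|[|[|[|m]]]]] lt_i5].
Qed.

Lemma dotvE a x : dotv a x = a@[0] * x@[0] + a@[1] * x@[1]
  + a@[2] * x@[2] + a@[3] * x@[3] + a@[4] * x@[4].
Proof.
rewrite /dotv (eq_bigr (fun i : 'I_5 => a@[i] * x@[i])) => [|i _].
  by rewrite !big_ord_recr big_ord0 /= add0r.
by rewrite inord_val.
Qed.

Lemma dotvDr a x y : dotv a (x + y) = dotv a x + dotv a y.
Proof. by rewrite !dotvE !mxE; ring. Qed.

Lemma dotvDl a d x : dotv (a + d) x = dotv a x + dotv d x.
Proof. by rewrite !dotvE !mxE; ring. Qed.

Lemma dotvZr a c x : dotv a (c *: x) = c * dotv a x.
Proof. by rewrite !dotvE !mxE; ring. Qed.

Lemma dotvZl c a x : dotv (c *: a) x = c * dotv a x.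
Proof. by rewrite !dotvE !mxE; ring. Qed.

Lemma QfZ c x : Qf (c *: x) = c ^+ 2 * Qf x.
Proof. by rewrite /Qf !mxE; ring. Qed.

Lemma QfD x y : Qf (x + y) = Qf x + Qf y + bf x y.
Proof. by rewrite /bf; ring. Qed.

Lemma Qf0 : Qf (0 : vec) = 0.
Proof. by rewrite /Qf !mxE; ring. Qed.

Lemma dotv0r a : dotv a 0 = 0.
Proof. by rewrite dotvE !mxE; ring. Qed.

(** Coordinate 0 is zero because the term [2 x0 y0] of the polar form vanishes in characteristic
    2. *)
Definition dual d : vec := row5 [:: 0; d@[2]; d@[1]; d@[4]; d@[3]].

(** In characteristic 2 this vector spans the radical of [bf]; adding a multiple of it changes
    [dotv a] while leaving [bf] and [dual] unchanged. *)
Definition nucleus : vec := row5 [:: 1; 0; 0; 0; 0].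

Lemma dualD x y : dual (x + y) = dual x + dual y.
Proof. by apply: row5P; rewrite !(row5E, mxE) ?inordK //= addr0. Qed.

Lemma dualZ c x : dual (c *: x) = c *: dual x.
Proof. by apply: row5P; rewrite !(row5E, mxE) ?inordK //= mulr0. Qed.

Lemma dual_nucleus : dual nucleus = 0.
Proof. by apply: row5P; rewrite !(row5E, mxE) ?inordK. Qed.

Lemma dual_coord0 d : (dual d)@[0] = 0.
Proof. by rewrite row5E. Qed.

Lemma Qf_nucleus : Qf nucleus = 1.
Proof. by rewrite /Qf !row5E //=; ring. Qed.

Lemma dotv_nucleus a : dotv a nucleus = a@[0].
Proof. by rewrite dotvE !row5E //=; ring. Qed.

Lemma pnorm_neq0 x : pnorm x -> x != 0.
Proof.
case/existsP=> i /andP[/eqP xi1 _]; apply/eqP=> x0.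
by move: xi1; rewrite x0 mxE => /eqP; rewrite eq_sym oner_eq0.
Qed.

Lemma pnormZ_ex x : x != 0 -> exists2 c, c != 0 & pnorm (c *: x).
Proof.
move=> xN0.
have [i0 xi0] : exists i, x ord0 i != 0.
  apply/existsP; rewrite -negb_forall; apply: contra xN0 => /forallP x0.
  by apply/eqP/rowP=> i; rewrite mxE; apply/eqP.
case: (arg_minnP (fun i : 'I_5 => i : nat) (xi0 : (fun i => x ord0 i != 0) i0)).
move=> i xi min_i; exists (x ord0 i)^-1; first by rewrite invr_eq0.
apply/existsP; exists i; rewrite mxE mulVf // eqxx /=.
apply/forallP=> j; apply/implyP=> lt_ji; rewrite mxE mulf_eq0; apply/orP; right.
by apply: contraLR lt_ji => xj; rewrite -leqNgt min_i.
Qed.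

(** Proportional vectors have the same first nonzero position; both entries there are 1, so the
    scalar is 1. *)
Lemma pnormZ_inj x c : pnorm x -> pnorm (c *: x) -> c *: x = x.
Proof.
move=> /existsP[i /andP[/eqP xi /forallP x_lt]].
move=> /existsP[j /andP[/eqP cxj /forallP cx_lt]].
have cN0 : c != 0.
  by apply: contra_eq_neq cxj => ->; rewrite scale0r mxE eq_sym oner_eq0.
have xj : x ord0 j != 0.
  by apply: contra_eq_neq cxj => xj; rewrite mxE xj mulr0 eq_sym oner_eq0.
case: (ltngtP i j) => [lt_ij | lt_ji | /val_inj eq_ij].
- by move/(_ i)/implyP/(_ lt_ij): cx_lt; rewrite mxE xi mulr1 (negPf cN0).
- by move/(_ j)/implyP/(_ lt_ji): x_lt; rewrite (negPf xj).
by move: cxj; rewrite mxE -eq_ij xi mulr1 => ->; rewrite scale1r.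
Qed.

Definition ovoid a : {set vec} := [set v in Q0 F | dotv a v == 0].

Lemma mem_ovoid a x :
  reflect [/\ pnorm x, Qf x = 0 & dotv a x = 0] (x \in ovoid a).
Proof.
rewrite !inE; apply: (iffP andP) => [[/andP[-> /eqP->] /eqP->] //|].
by case=> -> -> ->; rewrite eqxx.
Qed.

(* In characteristic 2 a hyperplane with nonzero first coordinate misses the
   nucleus, so only the absence of lines has to be required. *)
Definition elliptic a : Prop :=
  a@[0] = 1 /\
  forall x y, dotv a x = 0 -> dotv a y = 0 -> Qf x = 0 -> Qf y = 0 ->
    bf x y = 0 -> x = 0 \/ exists c, y = c *: x.

Definition tangent_vector a d : Prop := [/\ dotv a d = 0, Qf d = 0 & d != 0].

(** * The polar form in characteristic 2 *)

Hypothesis char2 : 2 \in [pchar F].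

(** Reduces an identity valid only modulo 2 to one that [ring] can prove; [w] collects half of the
    even terms. *)
Lemma eq_mod2 (u v : F) w : u = v + 2%:R * w -> u = v.
Proof. by rewrite (pcharf0 char2) mul0r addr0. Qed.

Lemma addff (u : F) : u + u = 0.
Proof. exact: addrr_pchar2. Qed.

Lemma addvv x : x + x = 0.
Proof. by apply/rowP=> i; rewrite !mxE addff. Qed.

Lemma addKv x y : x + (x + y) = y.
Proof. by rewrite addrA addvv add0r. Qed.

Lemma addf_eq0 (u v : F) : u + v = 0 -> u = v.
Proof. by move/eqP; rewrite addr_eq0 oppr_pchar2 // => /eqP. Qed.

Lemma addv_eq0 x y : x + y = 0 -> x = y.
Proof. by move=> xy; rewrite -[y](addKv x) xy addr0. Qed.

(** Frobenius is injective, hence bijective on a finite field. *)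
Lemma sqrt_ex (u : F) : exists t, t ^+ 2 = u.
Proof.
have /injF_bij[g _ gK] := fmorph_inj (pFrobenius_aut char2).
by exists (g u); rewrite -[RHS]gK.
Qed.

Lemma bfE x y : bf x y = x@[1] * y@[2] + x@[2] * y@[1]
  + x@[3] * y@[4] + x@[4] * y@[3].
Proof.
rewrite /bf /Qf !mxE; apply: (@eq_mod2 _ _ (x@[0] * y@[0])); ring.
Qed.

Lemma bfC x y : bf x y = bf y x.
Proof. by rewrite !bfE; ring. Qed.

Lemma bfDr x y z : bf x (y + z) = bf x y + bf x z.
Proof. by rewrite !bfE !mxE; ring. Qed.

Lemma bfDl x y z : bf (x + y) z = bf x z + bf y z.
Proof. by rewrite !bfE !mxE; ring. Qed.

Lemma bfZr c x y : bf x (c *: y) = c * bf x y.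
Proof. by rewrite !bfE !mxE; ring. Qed.

Lemma bfZl c x y : bf (c *: x) y = c * bf x y.
Proof. by rewrite !bfE !mxE; ring. Qed.

Lemma bfxx x : bf x x = 0.
Proof.
by rewrite bfE; apply: (@eq_mod2 _ _ (x@[1] * x@[2] + x@[3] * x@[4])); ring.
Qed.

Lemma bf0l x : bf 0 x = 0.
Proof. by rewrite bfE !mxE; ring. Qed.

Lemma bf_nucleusr x : bf x nucleus = 0.
Proof. by rewrite bfE !row5E //=; ring. Qed.

Lemma bf_nucleusl x : bf nucleus x = 0.
Proof. by rewrite bfC bf_nucleusr. Qed.

Lemma dotv_dual d x : dotv (dual d) x = bf d x.
Proof. by rewrite dotvE bfE !row5E //=; ring. Qed.

(** The difference [a + a'] has coordinate 0 equal to zero, and on such vectors [dual] is an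
    involution. A multiple of the nucleus then moves the preimage into the hyperplane of [a]. *)
Lemma dual_onto a a' : a@[0] = 1 -> a'@[0] = 1 ->
  exists2 d, dotv a d = 0 & a' = a + dual d.
Proof.
move=> a0 a'0; pose e := dual (a + a').
exists (e + dotv a e *: nucleus).
  by rewrite dotvDr dotvZr dotv_nucleus a0 mulr1 addff.
rewrite dualD dualZ dual_nucleus scaler0 addr0.
have -> : dual e = a + a'.
  by apply: row5P; rewrite !(row5E, mxE) //= ?a0 ?a'0 ?addff.
by rewrite addKv.
Qed.

(** The radical of [bf] is spanned by the nucleus, which is off the hyperplane since [a] takes the
    value 1 there. Any vector not orthogonal to [x] can be moved into the hyperplane along the
    nucleus, then scaled. *)
Lemma bf_nondeg a x : a@[0] = 1 -> dotv a x = 0 -> x != 0 ->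
  exists2 u, dotv a u = 0 & bf x u = 1.
Proof.
move=> a0 ax xN0.
suff [u xu] : exists u, bf x u != 0.
  exists ((bf x u)^-1 *: (u + dotv a u *: nucleus)).
    by rewrite dotvZr dotvDr dotvZr dotv_nucleus a0 mulr1 addff mulr0.
  by rewrite bfZr bfDr bfZr bf_nucleusr mulr0 addr0 mulVf.
case: (boolP (dual x == 0)) => [/eqP dx0 | dxN0].
  case/eqP: xN0; have dxk k : (dual x)@[k] = 0 by rewrite dx0 mxE.
  have x1 : x@[1] = 0 by have := dxk 2; rewrite row5E.
  have x2 : x@[2] = 0 by have := dxk 1; rewrite row5E.
  have x3 : x@[3] = 0 by have := dxk 4; rewrite row5E.
  have x4 : x@[4] = 0 by have := dxk 3; rewrite row5E.
  move: ax; rewrite dotvE a0 x1 x2 x3 x4 !mulr0 !addr0 mul1r => x00.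
  by apply: row5P; rewrite mxE.
have [i di] : exists i, dual x ord0 i != 0.
  apply/existsP; rewrite -negb_forall; apply: contra dxN0 => /forallP z.
  by apply/eqP/rowP=> i; rewrite [RHS]mxE; apply/eqP.
exists (delta_mx ord0 i); rewrite -dotv_dual /dotv (bigD1 i) //= big1 => [|j ji].
  by rewrite [delta_mx _ _ _ _]mxE !eqxx mulr1 addr0.
by rewrite [delta_mx _ _ _ _]mxE (negPf ji) andbF mulr0.
Qed.

(** A Gram-Schmidt argument: [z] is [y] made orthogonal to [u1], and [u2] is then corrected along
    [u1] to become orthogonal to [x]. *)
Lemma bf_separate a x y : a@[0] = 1 -> dotv a x = 0 -> dotv a y = 0 ->
  x != 0 -> (forall c, y != c *: x) ->
  exists u, [/\ dotv a u = 0, bf x u = 0 & bf y u = 1].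
Proof.
move=> a0 ax ay xN0 yN.
have [u1 au1 xu1] := bf_nondeg a0 ax xN0.
pose z := y + bf y u1 *: x.
have zu1 : bf z u1 = 0 by rewrite bfDl bfZl xu1 mulr1 addff.
have zN0 : z != 0 by apply: contraNneq (yN (bf y u1)) => /addv_eq0 /eqP.
have az : dotv a z = 0 by rewrite dotvDr dotvZr ax ay mulr0 addr0.
have [u2 au2 zu2] := bf_nondeg a0 az zN0.
exists (u2 + bf x u2 *: u1).
have xu : bf x (u2 + bf x u2 *: u1) = 0 by rewrite bfDr bfZr xu1 mulr1 addff.
split=> //; first by rewrite dotvDr dotvZr au1 au2 mulr0 addr0.
have <- : z + bf y u1 *: x = y by rewrite addrC /z [y + _]addrC addKv.
by rewrite bfDl bfZl xu mulr0 addr0 bfDr bfZr zu1 zu2 mulr0 addr0.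
Qed.

Lemma elliptic_sectionP a : elliptic a -> elliptic_section a.
Proof.
case=> a0 noline; split; last split=> // x ax xN0 _.
  apply/eqP=> az; move: a0; rewrite az mxE => /esym/eqP.
  by rewrite oner_eq0.
have [u au xu] := bf_nondeg a0 ax xN0.
by exists u; rewrite xu oner_eq0.
Qed.

(** Otherwise the hyperplane contains the nucleus and [dual a]. With [t] a square root of
    [Qf (dual a)], [x] is a singular vector whose polar form is [dotv a] itself, so it is in the
    radical of the section. *)
Lemma elliptic_section_coord0 a : elliptic_section a -> a@[0] != 0.
Proof.
case=> aN0 [nondeg _]; apply/eqP=> a0.
have [t tE] := sqrt_ex (Qf (dual a)).
pose x := dual a + t *: nucleus.
have dd : dual (dual a) = a.
  by apply: row5P; rewrite !(row5E, mxE) //= a0.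
have ax : dotv a x = 0.
  by rewrite dotvDr dotvZr dotv_nucleus a0 mulr0 addr0 -{1}dd dotv_dual bfxx.
have dx : dual x = a by rewrite dualD dualZ dual_nucleus scaler0 addr0.
have xN0 : x != 0.
  apply: contraNneq aN0 => x0; rewrite -dx x0 -(scale0r (0 : vec)) dualZ.
  by rewrite !scale0r.
have Qx : Qf x = 0.
  rewrite QfD QfZ Qf_nucleus bfZr bf_nucleusr mulr0 addr0 mulr1 tE.
  exact: addff.
have [y [ay]] := nondeg x ax xN0 Qx.
by rewrite -dotv_dual dx ay eqxx.
Qed.

Lemma elliptic_ovoidP (X : {set vec}) :
  elliptic_ovoid X <-> exists2 a, elliptic a & X = ovoid a.
Proof.
split=> [[a [ell_a ->]] | [a ell_a ->]]; last first.
  by exists a; split=> //; apply: elliptic_sectionP.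
have a0 := elliptic_section_coord0 ell_a.
have dot0 x : dotv (a@[0]^-1 *: a) x = 0 <-> dotv a x = 0.
  rewrite dotvZl; split=> [/eqP | ->]; last by rewrite mulr0.
  by rewrite mulf_eq0 invr_eq0 (negPf a0) => /eqP.
exists (a@[0]^-1 *: a).
  split=> [|x y /dot0 ax /dot0 ay]; first by rewrite mxE mulVf.
  by case: ell_a => _ [_ noline]; apply: noline.
by apply/setP=> x; rewrite !inE; congr (_ && _); apply/eqP/eqP => /dot0.
Qed.

(** * Tangency of two ovoids and change of the base ovoid *)

Lemma ovoid_inter_tangent a d p :
  elliptic a -> tangent_vector a d -> pnorm p -> (exists c, p = c *: d) ->
  ovoid a :&: ovoid (a + dual d) = [set p].
Proof.
move=> [a0 noline] [ad Qd dN0] np [c pE].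
apply/setP=> x; rewrite !inE; apply/idP/eqP => [|->].
  case/andP=> /andP[/andP[nx /eqP Qx] /eqP ax] /andP[_ /eqP].
  rewrite dotvDl ax add0r dotv_dual => dx.
  have [d0|[k xE]] := noline _ _ ad ax Qd Qx dx; first by rewrite d0 eqxx in dN0.
  have cN0 : c != 0.
    by apply: contraTneq (pnorm_neq0 np) => c0; rewrite pE c0 scale0r eqxx.
  have xE' : x = (k / c) *: p by rewrite pE scalerA divfK.
  by rewrite xE' pnormZ_inj // -xE'.
by rewrite np dotvDl dotv_dual pE QfZ dotvZr bfZr ad Qd bfxx !mulr0 addr0 eqxx.
Qed.

(** Correcting [u] along [d] gives a singular vector [x] of the section with [bf d x = 1]: its point
    is on the first ovoid and off the second. *)
Lemma ovoid_tangent_neq a d :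
  elliptic a -> tangent_vector a d -> ovoid a != ovoid (a + dual d).
Proof.
move=> [a0 _] [ad Qd dN0].
have [u au du] := bf_nondeg a0 ad dN0.
pose x := u + Qf u *: d.
have dx : bf d x = 1 by rewrite bfDr bfZr bfxx mulr0 addr0.
have Qx : Qf x = 0.
  by rewrite QfD QfZ Qd bfZr bfC du mulr0 addr0 mulr1 addff.
have xN0 : x != 0.
  apply/eqP=> x0; move/eqP: dx; rewrite x0 bfC bf0l eq_sym.
  by rewrite oner_eq0.
have [c cN0 nx] := pnormZ_ex xN0.
apply/eqP=> /setP/(_ (c *: x)); rewrite !inE nx dotvDl dotv_dual bfZr dx QfZ Qx.
rewrite dotvZr dotvDr dotvZr au ad !mulr0 add0r mulr0 add0r mulr1 eqxx.
by rewrite (negPf cN0).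
Qed.

Lemma tangent_adj a d :
  elliptic a -> tangent_vector a d -> adjG (ovoid a) (ovoid (a + dual d)).
Proof.
move=> ell_a td; split; first exact: ovoid_tangent_neq.
have [_ _ dN0] := td; have [c _ np] := pnormZ_ex dN0.
rewrite (ovoid_inter_tangent ell_a td np) ?cards1 //.
by exists c.
Qed.

(* If [Qf d] were nonzero, every line through [d] in the plane [d^perp] would
   carry a singular point, so the two ovoids would share more than one point. *)
Lemma adj_tangent a d : elliptic a -> dotv a d = 0 ->
  adjG (ovoid a) (ovoid (a + dual d)) -> tangent_vector a d.
Proof.
move=> [a0 noline] ad [neq /eqP/cards1P[p interE]].
have dN0 : d != 0.
  apply: contraNneq neq => ->; rewrite -(scale0r (0 : vec)) dualZ.
  by rewrite scale0r addr0.
split=> //; apply/eqP/negPn/negP => QdN0.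
have: p \in ovoid a :&: ovoid (a + dual d) by rewrite interE set11.
case/setIP=> /mem_ovoid[np Qp ap] /mem_ovoid[_ _].
rewrite dotvDl ap add0r dotv_dual => dp.
have pN c : p != c *: d.
  apply: contraTneq (pnorm_neq0 np) => pE; move/eqP: Qp.
  rewrite pE QfZ mulf_eq0 (negPf QdN0) orbF expf_eq0 /= => /eqP->.
  by rewrite scale0r eqxx.
have [u [au du pu]] := bf_separate a0 ad ap dN0 pN.
(* Since [u] is orthogonal to [d], this [t] gives [Qf (u + t *: d) = Qf u + Qf u = 0]. The resulting
   common point pairs nontrivially with [p], so it differs from [p]. *)
have [t tE] := sqrt_ex (Qf u / Qf d).
pose x := u + t *: d.
have px : bf p x = 1 by rewrite bfDr bfZr pu bfC dp mulr0 addr0.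
have xN0 : x != 0.
  by apply/eqP=> x0; move/eqP: px; rewrite x0 bfC bf0l eq_sym oner_eq0.
have [c cN0 nx] := pnormZ_ex xN0.
have: c *: x \in ovoid a :&: ovoid (a + dual d).
  have ax : dotv a (c *: x) = 0 by rewrite dotvZr dotvDr dotvZr au ad !(mulr0, addr0).
  have dx : bf d (c *: x) = 0 by rewrite bfZr bfDr bfZr bfxx du !(mulr0, addr0).
  have Qx : Qf (c *: x) = 0.
    rewrite QfZ QfD QfZ tE divfK // bfZr bfC du mulr0 addr0 addff.
    by rewrite mulr0.
  apply/setIP; split; apply/mem_ovoid; split=> //.
  by rewrite dotvDl dotv_dual ax dx addr0.
rewrite interE inE => /eqP cx.
have := bfxx p; rewrite -{2}cx bfZr px mulr1 => /eqP.
by rewrite (negPf cN0).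
Qed.

(* [x |-> x + (d, x) d + (d, x) nucleus] is an isometry carrying one section to
   the other. *)
Lemma elliptic_tangent a d :
  elliptic a -> dotv a d = 0 -> Qf d = 0 -> elliptic (a + dual d).
Proof.
move=> [a0 noline] ad Qd; split; first by rewrite mxE a0 dual_coord0 addr0.
pose f x := x + bf d x *: (d + nucleus).
have fZ c x : f (c *: x) = c *: f x by rewrite /f bfZr -scalerA -scalerDr.
have df x : bf d (f x) = bf d x.
  by rewrite bfDr bfZr bfDr bfxx bf_nucleusr addr0 mulr0 addr0.
have fK x : f (f x) = x by rewrite {1}/f df /f -addrA addvv addr0.
have Qf_f x : Qf (f x) = Qf x.
  rewrite QfD QfZ QfD Qd Qf_nucleus bf_nucleusr bfZr bfDr bf_nucleusr [bf x d]bfC.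
  by rewrite add0r !addr0 mulr1 -expr2 -addrA addff addr0.
have bf_f x y : bf (f x) (f y) = bf x y.
  rewrite {1}/f bfDl bfZl bfDl df bf_nucleusl addr0 /f bfDr bfZr bfDr.
  by rewrite bf_nucleusr addr0 [bf x d]bfC [bf d y * _]mulrC -addrA addff addr0.
have dot_f x : dotv (a + dual d) x = 0 -> dotv a (f x) = 0.
  by rewrite dotvDl dotv_dual /f dotvDr dotvZr dotvDr ad add0r dotv_nucleus a0 mulr1.
move=> x y /dot_f ax /dot_f ay; rewrite -(Qf_f x) -(Qf_f y) -bf_f => Qx Qy xy.
have [fx0 | [c fy]] := noline _ _ ax ay Qx Qy xy.
  by left; rewrite -[x]fK fx0 /f bfC bf0l scale0r addr0.
by right; exists c; rewrite -[y]fK fy fZ fK.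
Qed.

(** Re-bases the pair at [ovoid (a + dual d)]. The natural difference [d + e] takes the value
    [bf d e] on the new equation, and the nucleus term cancels it, adding [bf d e ^+ 2] to [Qf]. *)
Lemma tangent_vector_shift a d e : a@[0] = 1 ->
  dotv a d = 0 -> dotv a e = 0 -> Qf d = 0 -> Qf e = 0 ->
  exists f, [/\ dotv (a + dual d) f = 0, a + dual e = a + dual d + dual f,
    Qf f = bf d e ^+ 2 + bf d e & d != e -> f != 0].
Proof.
move=> a0 ad ae Qd Qe; exists (d + e + bf d e *: nucleus); split.
- rewrite dotvDl !dotvDr !dotvZr !dotv_dual ad ae dotv_nucleus a0.
  by rewrite bfxx bf_nucleusr !(mulr0, addr0, add0r, mulr1) addff.
- by rewrite !dualD dualZ dual_nucleus scaler0 addr0 -addrA addKv.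
- rewrite !QfD QfZ Qf_nucleus Qd Qe bfZr bf_nucleusr.
  by rewrite !(mulr0, addr0, add0r, mulr1) addrC.
(* If [f = 0], then [d + e] is a multiple of the nucleus; applying [dotv a] shows that this multiple
   is zero. *)
move=> neq; apply: contra_neq neq => /addv_eq0 de.
suff k0 : bf d e = 0 by move: de; rewrite k0 scale0r => /addv_eq0.
have: dotv a (d + e) = 0 by rewrite dotvDr ad ae addr0.
by rewrite de dotvZr dotv_nucleus a0 mulr1.
Qed.

End Coordinates.

Section Cliques.
Local Open Scope ring_scope.
Variable F : finFieldType.
Notation vec := 'rV[F]_5.
Implicit Types (x y z a d e : vec) (c t : F) (C : {set {set vec}}) (D : {set vec}).
Hypothesis char2 : 2 \in [pchar F].
Local Notation "x @[ k ]" := (x ord0 (inord k : 'I_5)) (at level 2).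

Lemma dual0 : dual (0 : vec) = 0.
Proof. by rewrite -[X in dual X](scale0r (0 : vec)) dualZ scale0r. Qed.

Lemma adj_shift a d e : elliptic a ->
    dotv a d = 0 -> dotv a e = 0 -> Qf d = 0 -> Qf e = 0 -> d != e ->
  adjG (ovoid (a + dual d)) (ovoid (a + dual e)) <-> bf d e ^+ 2 + bf d e = 0.
Proof.
move=> ell_a ad ae Qd Qe neq; have [a0 _] := ell_a.
have ell_ad := elliptic_tangent char2 ell_a ad Qd.
have [f [af -> <- /(_ neq) fN0]] := tangent_vector_shift char2 a0 ad ae Qd Qe.
by split=> [/(adj_tangent char2 ell_ad af)[] | Qf0] //; apply: tangent_adj.
Qed.

Lemma adj_shift01 a d e : elliptic a ->
    dotv a d = 0 -> dotv a e = 0 -> Qf d = 0 -> Qf e = 0 -> d != e ->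
  adjG (ovoid (a + dual d)) (ovoid (a + dual e)) <-> bf d e = 0 \/ bf d e = 1.
Proof.
move=> ell_a ad ae Qd Qe neq.
have -> : (bf d e = 0 \/ bf d e = 1) <-> bf d e ^+ 2 + bf d e = 0.
  rewrite expr2 -[X in _ * _ + X]mulr1 -mulrDr; split.
    by case=> ->; rewrite ?mul0r // mul1r addff.
  by move/eqP; rewrite mulf_eq0 => /orP[/eqP|/eqP/(addf_eq0 char2)]; [left|right].
exact: adj_shift.
Qed.

(** * Non-linear cliques as frames of tangent vectors *)

Definition frame a D : Prop :=
  [/\ elliptic a, {in D, forall d, tangent_vector a d} &
      {in D &, forall d e, d != e -> bf d e = 1}].

(** The vector 0 stands for the base ovoid [ovoid a]. *)
Definition frame_clique a D : {set {set vec}} :=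
  [set ovoid (a + dual d) | d in 0 |: D].

Lemma frame_adj a D : frame a D ->
  {in 0 |: D &, forall d e, d != e -> adjG (ovoid (a + dual d)) (ovoid (a + dual e))}.
Proof.
case=> ell_a tD bD d e d_in e_in neq.
have sing x : x \in 0 |: D -> dotv a x = 0 /\ Qf x = 0.
  by case/setU1P=> [->|/tD[]//]; rewrite dotv0r Qf0.
have [[ad Qd] [ae Qe]] := (sing _ d_in, sing _ e_in).
apply/adj_shift01 => //.
case/setU1P: d_in => [->|dD]; first by left; rewrite bf0l.
case/setU1P: e_in => [->|eD]; first by left; rewrite bfC ?bf0l.
by right; apply: bD.
Qed.

Lemma frame_cliqueG a D : frame a D -> cliqueG (frame_clique a D).
Proof.
move=> fD; split=> [X | X Y] /imsetP[d d_in ->].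
  apply/elliptic_ovoidP => //; exists (a + dual d) => //.
  case: fD => ell_a tD _; apply: elliptic_tangent => //.
    by case/setU1P: d_in => [->|/tD[]//]; rewrite dotv0r.
  by case/setU1P: d_in => [->|/tD[]//]; rewrite Qf0.
case/imsetP=> e e_in -> neq; apply: (frame_adj fD) => //.
by apply: contraNneq neq => ->.
Qed.

Lemma card_frame_clique a D : frame a D -> #|frame_clique a D| = #|D|.+1.
Proof.
move=> fD; rewrite card_in_imset => [|d e d_in e_in eq_de].
  rewrite cardsU1; case: fD => _ tD _.
  by case: (boolP (0 \in D)) => // /tD[_ _]; rewrite eqxx.
apply/eqP; apply: contra_eqT eq_de => neq.
by case: (frame_adj fD d_in e_in neq).
Qed.

(** The base point of a rosette containing the clique would be singular and orthogonal to [d] and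
    [e]. The first makes it a multiple of [d], and [bf e d = 1] then makes it zero. *)
Lemma frame_nonlinear a D d e : frame a D -> d \in D -> e \in D -> d != e ->
  nonlinear_clique (frame_clique a D).
Proof.
move=> fD dD eD neq; split; first exact: frame_cliqueG.
case=> _ [p [R [[pQ [_ [_ interR]]] /subsetP sCR]]].
have [[a0 noline] tD bD] := fD.
have [[ad Qd dN0] [ae Qe eN0]] := (tD d dD, tD e eD).
have p_in f : f \in 0 |: D -> p \in ovoid (a + dual f).
  suff two g h : g \in 0 |: D -> h \in 0 |: D -> g != h ->
      p \in ovoid (a + dual g) /\ p \in ovoid (a + dual h).
    (* Each member needs a distinct partner to meet in [p]: [e] for the vector [d], and [d] for
       every other vector. *)
    move=> f_in; case: (eqVneq f d) f_in => [-> _ | fd f_in].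
      by case: (two d e) => //; rewrite !inE ?dD ?eD orbT.
    by case: (two f d) => //; rewrite !inE dD orbT.
  move=> g_in h_in /(frame_adj fD g_in h_in)[gh _].
  apply/setIP; rewrite interR ?set11 //; apply: sCR; exact: imset_f.
have dot_in f : f \in 0 |: D -> dotv a p + bf f p = 0.
  by case/p_in/mem_ovoid=> _ _; rewrite dotvDl dotv_dual.
have ap : dotv a p = 0.
  by have := dot_in 0; rewrite bf0l // addr0 setU11; apply.
have /mem_ovoid[np Qp _] := p_in 0 (setU11 _ _).
have dp : bf d p = 0 by have := dot_in d; rewrite ap add0r !inE dD orbT; apply.
have ep : bf e p = 0 by have := dot_in e; rewrite ap add0r !inE eD orbT; apply.
have [d0 | [c pE]] := noline _ _ ad ap Qd Qp dp; first by rewrite d0 eqxx in dN0.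
move: ep (pnorm_neq0 np); rewrite pE bfZr // bfC // bD // mulr1 => ->.
by rewrite scale0r eqxx.
Qed.

(** Two members differ by [dual] of a nonzero multiple of [d], which is a tangent vector of the
    first; hence they meet exactly in the point of [d]. *)
Lemma tangent_rosette a d : elliptic a -> tangent_vector a d ->
  exists p, rosette p [set ovoid (a + dual (t *: d)) | t : F].
Proof.
move=> ell_a [ad Qd dN0]; have [a0 _] := ell_a.
have [c cN0 np] := pnormZ_ex dN0.
have ell t : elliptic (a + dual (t *: d)).
  by apply: elliptic_tangent => //; rewrite ?dotvZr ?QfZ ?ad ?Qd mulr0.
have diff s t : s != t -> [/\ a + dual (t *: d) = a + dual (s *: d) + dual ((s + t) *: d),
    tangent_vector (a + dual (s *: d)) ((s + t) *: d) & s + t != 0].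
  move=> neq; have stN0 : s + t != 0 by apply: contra_neq neq => /(addf_eq0 char2).
  split=> //; first by rewrite scalerDl dualD -addrA addKv.
  split; first by rewrite dotvDl dotv_dual // bfZl // !dotvZr
      bfZr // bfxx // ad !mulr0 addr0.
    by rewrite QfZ Qd mulr0.
  by rewrite scaler_eq0 negb_or stN0.
exists (c *: d); split; [|split; [|split]].
- by rewrite inE np QfZ Qd mulr0 eqxx.
- rewrite card_imset // => s t eq_st; apply/eqP; apply: contra_eqT eq_st => neq.
  have [-> td _] := diff s t neq.
  exact: ovoid_tangent_neq.
- move=> X /imsetP[t _ ->]; apply/elliptic_ovoidP => //.
  by exists (a + dual (t *: d)).
move=> X Y /imsetP[s _ ->] /imsetP[t _ ->] neq.
have{neq} neq : s != t by apply: contraNneq neq => ->.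
have [-> td stN0] := diff s t neq.
apply: ovoid_inter_tangent => //.
by exists (c / (s + t)); rewrite scalerA divfK.
Qed.

(* Two tangent vectors with [bf d e = 0] are proportional, and then no vector
   can pair to 1 with both: the whole clique lies in the rosette of [d]. *)
Lemma nonlinear_frame C : nonlinear_clique C -> C != set0 ->
  exists a D, frame a D /\ C = frame_clique a D.
Proof.
move=> [[ellC adjC] nonlin] /set0Pn[X0 X0C].
have /(elliptic_ovoidP char2)[a ell_a X0E] := ellC _ X0C.
have [a0 noline] := ell_a.
pose D := [set d | [&& d != 0, dotv a d == 0, Qf d == 0 & ovoid (a + dual d) \in C]].
have tD : {in D, forall d, tangent_vector a d}.
  by move=> d; rewrite inE => /and4P[dN0 /eqP ad /eqP Qd _].
have CE : C = frame_clique a D.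
  apply/setP=> X; apply/idP/imsetP => [XC | [d /setU1P[->|dD] ->]].
  - case: (eqVneq X X0) => [-> | neq].
      by exists 0; rewrite ?setU11 // dual0 addr0.
    have /(elliptic_ovoidP char2)[a' [a'0 _] XE] := ellC _ XC.
    have [d ad a'E] := dual_onto char2 a0 a'0.
    have adj : adjG (ovoid a) (ovoid (a + dual d)).
      by rewrite -a'E -XE -X0E; apply: adjC => //; rewrite eq_sym.
    have [_ Qd dN0] := adj_tangent char2 ell_a ad adj.
    exists d; last by rewrite XE a'E.
    by rewrite !inE dN0 ad Qd !eqxx -a'E -XE XC orbT.
  - by rewrite dual0 addr0 -X0E.
  - by move: dD; rewrite inE => /and4P[].
exists a, D; split=> //; split=> // d e dD eD neq.
have b01 : {in D &, forall f g, f != g -> bf f g = 0 \/ bf f g = 1}.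
  move=> f g fD gD fg; have [af Qf' fN0] := tD _ fD; have [ag Qg gN0] := tD _ gD.
  (* Should distinct vectors give the same ovoid, the point of [f] would lie on
     [ovoid (a + dual g)], forcing product 0. *)
  case: (eqVneq (ovoid (a + dual f)) (ovoid (a + dual g))) => [fgE | neq_fg].
    have [c cN0 np] := pnormZ_ex fN0.
    have: c *: f \in ovoid a :&: ovoid (a + dual f).
      by rewrite (ovoid_inter_tangent char2 ell_a (tD _ fD) np) ?set11 //; exists c.
    rewrite fgE => /setIP[_ /mem_ovoid[_ _]].
    rewrite dotvDl dotv_dual // dotvZr af mulr0 add0r bfZr // bfC // => /eqP.
    by rewrite mulf_eq0 (negPf cN0) => /eqP; left.
  apply/(adj_shift01 ell_a af ag Qf' Qg fg).
  move: fD gD; rewrite !inE => /and4P[_ _ _ fC] /and4P[_ _ _ gC].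
  exact: adjC.
case: (b01 d e) => // de; case: nonlin; split=> //.
have [ad Qd dN0] := tD _ dD; have [ae Qe eN0] := tD _ eD.
have [d0 | [c eE]] := noline _ _ ad ae Qd Qe de; first by rewrite d0 eqxx in dN0.
have [p rosR] := tangent_rosette ell_a (tD _ dD).
exists p; exists [set ovoid (a + dual (t *: d)) | t : F]; split=> //.
rewrite CE; apply/subsetP=> _ /imsetP[f /setU1P[->|fD] ->].
  by apply/imsetP; exists 0; rewrite // scale0r.
have [af Qf' fN0] := tD _ fD.
suff df : bf d f = 0.
  have [d0 | [k ->]] := noline _ _ ad af Qd Qf' df; first by rewrite d0 eqxx in dN0.
  by apply/imsetP; exists k.
case: (eqVneq d f) => [<-|nedf]; first exact: bfxx.
case: (eqVneq e f) => [<-|neef] //.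
(* If [bf d f = 1] and [e = c *: d], then [bf e f = c] is 0 or 1, contradicting [e != 0] or
   [d != e]. *)
case: (b01 d f) => // df; case: (b01 e f) => //; rewrite eE bfZl // df mulr1 => c01.
  by rewrite eE c01 scale0r eqxx in eN0.
by rewrite eE c01 scale1r eqxx in neq.
Qed.


(** * Four tangent vectors with mutual products 1, and their sum *)

Section FourVectors.
Variables (a d1 d2 d3 d4 : vec).
Hypothesis ell_a : elliptic a.
Hypotheses (t1 : tangent_vector a d1) (t2 : tangent_vector a d2)
  (t3 : tangent_vector a d3) (t4 : tangent_vector a d4).
Hypotheses (b12 : bf d1 d2 = 1) (b13 : bf d1 d3 = 1) (b14 : bf d1 d4 = 1)
  (b23 : bf d2 d3 = 1) (b24 : bf d2 d4 = 1) (b34 : bf d3 d4 = 1).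

Definition fifth_vector := d1 + d2 + d3 + d4.
Local Notation s := fifth_vector.

Lemma bf_fifth_vectorl x :
  bf s x = bf d1 x + bf d2 x + bf d3 x + bf d4 x.
Proof. by rewrite !bfDl. Qed.

Lemma fifth_vector_bf : [/\ bf s d1 = 1, bf s d2 = 1, bf s d3 = 1 & bf s d4 = 1].
Proof.
rewrite !bf_fifth_vectorl !bfxx // (bfC _ d2 d1) // (bfC _ d3 d1) // (bfC _ d3 d2) //.
rewrite (bfC _ d4 d1) // (bfC _ d4 d2) // (bfC _ d4 d3) // b12 b13 b14 b23 b24 b34.
by split; apply: (@eq_mod2 _ char2 _ _ 1); ring.
Qed.

(** [Qf] of the sum counts the six pairs, and 6 is even; the sum is nonzero because it pairs to 1
    with [d1]. *)
Lemma fifth_vector_tangent : tangent_vector a s.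
Proof.
case: t1 t2 t3 t4 => [a1 Q1 _] [a2 Q2 _] [a3 Q3 _] [a4 Q4 _].
split; first by rewrite !dotvDr a1 a2 a3 a4 !addr0.
  rewrite !QfD !bfDl // Q1 Q2 Q3 Q4 b12 b13 b14 b23 b24 b34.
  by apply: (@eq_mod2 _ char2 _ _ 3%:R); ring.
have [s1 _ _ _] := fifth_vector_bf.
by apply: contra_eq_neq s1 => ->; rewrite bf0l // eq_sym oner_eq0.
Qed.

(** The product of [d] with the sum is 4 = 0, so [d] is a multiple of the sum, and [bf d1 d = 1]
    fixes the scalar. *)
Lemma fifth_vector_unique d : tangent_vector a d ->
  bf d1 d = 1 -> bf d2 d = 1 -> bf d3 d = 1 -> bf d4 d = 1 -> d = s.
Proof.
move=> [ad Qd dN0] b1 b2 b3 b4; have [as_ Qs sN0] := fifth_vector_tangent.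
have [_ noline] := ell_a; have [s1 _ _ _] := fifth_vector_bf.
have sd : bf s d = 0.
  rewrite bf_fifth_vectorl b1 b2 b3 b4.
  by apply: (@eq_mod2 _ char2 _ _ 2%:R); ring.
have [s0 | [c dE]] := noline _ _ as_ ad Qs Qd sd; first by rewrite s0 eqxx in sN0.
by move: b1; rewrite dE bfZr // bfC // s1 mulr1 => ->; rewrite scale1r.
Qed.

(* [d1 + w d2 + w^2 d3] and [s] would span a line of the section. *)
Lemma no_cube_root_of_unity (w : F) : w ^+ 2 + w + 1 != 0.
Proof.
apply/eqP=> w0; have [_ noline] := ell_a.
case: t1 t2 t3 t4 => [a1 Q1 _] [a2 Q2 _] [a3 Q3 _] [a4 Q4 _].
have [as_ Qs sN0] := fifth_vector_tangent; have [s1 s2 s3 s4] := fifth_vector_bf.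
pose x := d1 + w *: d2 + w ^+ 2 *: d3.
have ax : dotv a x = 0 by rewrite !dotvDr !dotvZr a1 a2 a3 !mulr0 !addr0.
have Qx : Qf x = 0.
  (* The products contribute [w + w ^+ 2 + w ^+ 3], which is [w] times the vanishing quadratic. *)
  rewrite !QfD !QfZ !bfDl // !bfZr // !bfZl // Q1 Q2 Q3 b12 b13 b23.
  by rewrite -(mulr0 w) -[X in _ = w * X]w0; ring.
have sx : bf s x = 0 by rewrite !bfDr // !bfZr // s1 s2 s3 !mulr1 addrC addrA -w0 addrAC.
have b4x : bf d4 x = 0.
  rewrite bfC // !bfDl // !bfZl // b14 b24 b34 !mulr1 -w0 addrC addrA.
  by rewrite addrAC.
have [s0 | [c xE]] := noline _ _ as_ ax Qs Qx sx; first by rewrite s0 eqxx in sN0.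
(* Pairing with [d4] gives [c = 0], hence [x = 0]; but [bf x d1] is [w + w ^+ 2], which is
   nonzero. *)
move: b4x; rewrite xE bfZr // bfC // s4 mulr1 => c0.
have : bf x d1 = 0 by rewrite xE c0 scale0r bf0l.
rewrite !bfDl // !bfZl // bfxx // (bfC _ d2) // (bfC _ d3) // b12 b13 !mulr1 add0r.
move=> w0'; move/eqP: w0; rewrite [w ^+ 2 + w]addrC w0' add0r.
by rewrite oner_eq0.
Qed.

End FourVectors.

Lemma frame4 a D : frame a D -> (3 < #|D|)%N -> exists d1 d2 d3 d4,
  [/\ {subset [:: d1; d2; d3; d4] <= D},
      uniq [:: d1; d2; d3; d4],
      [/\ tangent_vector a d1, tangent_vector a d2, tangent_vector a d3
        & tangent_vector a d4],
      [/\ bf d1 d2 = 1, bf d1 d3 = 1 & bf d1 d4 = 1] &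
      [/\ bf d2 d3 = 1, bf d2 d4 = 1 & bf d3 d4 = 1]].
Proof.
move=> [_ tD bD]; rewrite cardE; have := enum_uniq D.
case E: (enum D) => [|d1 [|d2 [|d3 [|d4 r]]]] // uniq_r _.
have in_r x : x \in [:: d1; d2; d3; d4] -> x \in D.
  by move=> x4; rewrite -mem_enum E -[_ :: _]/([:: d1; d2; d3; d4] ++ r) mem_cat x4.
have uniq4 : uniq [:: d1; d2; d3; d4].
  by move: uniq_r; rewrite -[_ :: _]/([:: d1; d2; d3; d4] ++ r) cat_uniq => /andP[].
have D1 : d1 \in D by rewrite in_r // !inE eqxx.
have D2 : d2 \in D by rewrite in_r // !inE eqxx orbT.
have D3 : d3 \in D by rewrite in_r // !inE eqxx !orbT.
have D4 : d4 \in D by rewrite in_r // !inE eqxx !orbT.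
exists d1, d2, d3, d4; split=> //.
- by split; apply: tD.
- move: uniq4; rewrite /= !inE !negb_or -!andbA => /and5P[n12 n13 n14 n23 _].
  by split; apply: bD.
- move: uniq4; rewrite /= !inE !negb_or -!andbA => /and5P[_ _ _ n23 /and3P[n24 n34 _]].
  by split; apply: bD.
Qed.

(** Any vector of [D] beyond four chosen ones pairs to 1 with each of them, so it is their sum. *)
Lemma card_frame a D : frame a D -> (#|D| <= 5)%N.
Proof.
move=> fD; case: leqP => // ltD; have := fD; case=> ell_a tD bD.
have [d1 [d2 [d3 [d4 [sub _ [t1 t2 t3 t4] [b12 b13 b14] [b23 b24 b34]]]]]] :=
  frame4 fD (ltnW (ltnW ltD)).
have sD5 : D \subset fifth_vector d1 d2 d3 d4 :: [:: d1; d2; d3; d4].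
  apply/subsetP=> d dD; rewrite in_cons orbC.
  case: (boolP (d \in [:: _; _; _; _])) => //= dN4.
  have bd x : x \in [:: d1; d2; d3; d4] -> bf x d = 1.
    by move=> x4; apply: bD (sub x x4) dD _; apply: contraNneq dN4 => <-.
  by apply/eqP; apply: (@fifth_vector_unique a) => //;
    [exact: tD | apply: bd; rewrite !inE eqxx ?orbT ..].
have := leq_trans (subset_leq_card sD5) (card_size _).
by rewrite leqNgt ltD.
Qed.

(** The sum of the four vectors is added; it is new because it pairs to 1 with each of them but to 0
    with itself. *)
Lemma frame_extend a D : frame a D -> #|D| = 4%N ->
  exists2 D', frame a D' & D \subset D' /\ #|D'| = 5%N.
Proof.
move=> fD cD; have := fD; case=> ell_a tD bD.
have [d1 [d2 [d3 [d4 [sub u4 [t1 t2 t3 t4] [b12 b13 b14] [b23 b24 b34]]]]]] :=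
  frame4 fD (eq_leq (esym cD)).
set s := fifth_vector d1 d2 d3 d4.
have DE : [:: d1; d2; d3; d4] =i D.
  by apply/subset_cardP; [rewrite (card_uniqP u4) cD | apply/subsetP].
have bs d : d \in D -> bf s d = 1.
  have [s1 s2 s3 s4] := fifth_vector_bf b12 b13 b14 b23 b24 b34.
  by rewrite -DE !inE => /or4P[] /eqP->.
have sD : s \notin D.
  by apply/negP=> /bs/eqP; rewrite bfxx // eq_sym oner_eq0.
exists (s |: D); last by rewrite subsetUr cardsU1 sD cD.
have ts : tangent_vector a s by apply: fifth_vector_tangent.
split=> // [d /setU1P[-> | /tD] // |].
move=> d e /setU1P[-> | dD] /setU1P[-> | eD] neq //.
- by rewrite eqxx in neq.
- exact: bs.
- by rewrite bfC // bs.
exact: bD.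
Qed.

(** * An explicit frame of four vectors *)

Lemma elliptic_example : (forall w : F, w ^+ 2 + w + 1 != 0) ->
  elliptic (row5 [:: 1; 1; 1; 0; 0] : vec).
Proof.
move=> no_root; split=> [|x y ax ay Qx Qy xy]; first by rewrite row5E.
(* On the hyperplane [x0 = x1 + x2] the form becomes [x1^2 + x1 x2 + x2^2 + x3 x4], an anisotropic
   binary form plus a hyperbolic plane. *)
have anis (u v : F) : u ^+ 2 + u * v + v ^+ 2 = 0 -> v = 0.
  move=> uv; apply/eqP; apply: contra_eqT uv => vN0.
  have -> : u ^+ 2 + u * v + v ^+ 2 = v ^+ 2 * ((u / v) ^+ 2 + u / v + 1) by field.
  by rewrite mulf_neq0 ?expf_neq0.
set a : vec := row5 _ in ax ay.
have flat z : dotv a z = 0 -> Qf z = 0 -> z@[3] * z@[4] = 0 ->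
    [/\ z@[0] = 0, z@[1] = 0 & z@[2] = 0].
  rewrite dotvE !row5E //= !mul1r !mul0r !addr0 -addrA => /(addf_eq0 char2) z0.
  rewrite /Qf z0 => Qz z34; rewrite z34 addr0 in Qz.
  have z2 : z@[2] = 0.
    by apply: (anis z@[1]); rewrite -Qz; apply/esym;
      apply: (@eq_mod2 _ char2 _ _ (z@[1] * z@[2])); ring.
  have z1 : z@[1] = 0.
    by apply: (anis z@[2]); rewrite -Qz; apply/esym;
      apply: (@eq_mod2 _ char2 _ _ (z@[1] * z@[2])); ring.
  by rewrite z1 z2 addr0.
(* A suitable [y + c *: x] has coordinate 3 or 4 equal to zero; [flat] and orthogonality to [x] then
   make it vanish. *)
have combo c : [/\ dotv a (y + c *: x) = 0, Qf (y + c *: x) = 0 & bf x (y + c *: x) = 0].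
  split; first by rewrite dotvDr dotvZr ax ay mulr0 addr0.
    by rewrite QfD QfZ bfZr // bfC // Qx Qy xy !mulr0 !addr0.
  by rewrite bfDr // bfZr // bfxx // xy mulr0 addr0.
have prop c : y + c *: x = 0 -> x = 0 \/ exists c, y = c *: x.
  by move/(addv_eq0 char2)=> yE; right; exists c.
case: (eqVneq x@[3] 0) => [x3|x3].
  case: (eqVneq x@[4] 0) => [x4|x4].
    by have [|x0 x1 x2] := flat x ax Qx _;
      [rewrite x3 mul0r | left; apply: row5P; rewrite mxE].
  have [az Qz xz] := combo (y@[4] / x@[4]); apply: (prop (y@[4] / x@[4])).
  set z := y + _ in az Qz xz *.
  have z4 : z@[4] = 0 by rewrite !mxE divfK // addff.
  have [|z0 z1 z2] := flat z az Qz _; first by rewrite z4 mulr0.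
  move: xz; rewrite bfE // z1 z2 z4 !mulr0 !add0r => /eqP.
  by rewrite mulf_eq0 (negPf x4) => /eqP z3; apply: row5P; rewrite [RHS]mxE.
have [az Qz xz] := combo (y@[3] / x@[3]); apply: (prop (y@[3] / x@[3])).
set z := y + _ in az Qz xz *.
have z3 : z@[3] = 0 by rewrite !mxE divfK // addff.
have [|z0 z1 z2] := flat z az Qz _; first by rewrite z3 mul0r.
move: xz; rewrite bfE // z1 z2 z3 !mulr0 !add0r addr0 => /eqP.
by rewrite mulf_eq0 (negPf x3) => /eqP z4; apply: row5P; rewrite [RHS]mxE.
Qed.

Lemma frame_example : (forall w : F, w ^+ 2 + w + 1 != 0) ->
  exists a D, frame a D /\ #|D| = 4%N.
Proof.
move=> no_root; have ell_a := elliptic_example no_root.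
set a : vec := row5 _ in ell_a.
(* [d1] and [d2] are the standard hyperbolic pair. Products 1 with both force coordinates 3 and 4 to
   be 1, so singularity means [x1^2 + x1 x2 + x2^2 = 1], solved by (1, 0) and (0, 1). *)
pose d1 : vec := row5 [:: 0; 0; 0; 1; 0].
pose d2 : vec := row5 [:: 0; 0; 0; 0; 1].
pose d3 : vec := row5 [:: 1; 1; 0; 1; 1].
pose d4 : vec := row5 [:: 1; 0; 1; 1; 1].
have tD d : d \in [:: d1; d2; d3; d4] -> tangent_vector a d.
  have tanP e k : dotv a e = 0 -> Qf e = 0 -> e@[k] = 1 -> tangent_vector a e.
    move=> ae Qe ek; split=> //; apply: contra_eq_neq ek => ->.
    by rewrite mxE eq_sym oner_eq0.
  rewrite !inE => /or4P[] /eqP->; [apply: (tanP _ 3%N) | apply: (tanP _ 4%N)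
    | apply: (tanP _ 4%N) | apply: (tanP _ 4%N)];
  rewrite // ?dotvE /Qf ?row5E //= !(mul0r, mulr0, mul1r, addr0, add0r) ?expr0n ?expr1n
    ?addff //.
have bf1_neq e f : bf e f = 1 -> e != f.
  by move=> ef; apply: contra_eq_neq ef => ->; rewrite bfxx // eq_sym oner_eq0.
have bd : [/\ bf d1 d2 = 1, bf d1 d3 = 1 & bf d1 d4 = 1] /\
    [/\ bf d2 d3 = 1, bf d2 d4 = 1 & bf d3 d4 = 1].
  split; split; rewrite bfE // !row5E //= !(mul0r, mulr0, mul1r, addr0, add0r) //.
  by apply: (@eq_mod2 _ char2 _ _ 1); ring.
have [[b12 b13 b14] [b23 b24 b34]] := bd.
exists a, [set d in [:: d1; d2; d3; d4]]; split; last first.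
  rewrite cardsE; apply/card_uniqP; rewrite /= !inE !negb_or.
  by rewrite !bf1_neq.
split=> // [d | d e]; first by rewrite inE => /tD.
rewrite !inE => /or4P[] /eqP-> /or4P[] /eqP->; rewrite ?eqxx // => _ //; by rewrite bfC.
Qed.

End Cliques.

(** * Cube roots of unity and the parity of the exponent *)

Section FieldOrder.
Local Open Scope ring_scope.
Variables (F : finFieldType) (n : nat).
Hypothesis cardF : #|F| = (2 ^ n)%N.

Lemma pchar2_card : 2 \in [pchar F].
Proof.
exact: card_finPcharP cardF isT.
Qed.

Lemma modn3_exp2 m : (2 ^ m = (odd m).+1 %[mod 3])%N.
Proof.
elim: m => // m IHm; rewrite expnS -modnMmr IHm modnMmr /=.
by case: (odd m).
Qed.

(** A root satisfies [w ^+ 3 = 1]. For odd [n], q is 2 modulo 3, so [w = w ^+ q = w ^+ 2] and the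
    quadratic reduces to 1. For even [n], q - 1 = 3m; without a root all 3m nonzero elements would
    satisfy [x ^+ m = 1], too many for degree m. *)
Lemma cube_root_of_unityP : odd n <-> (forall w : F, w ^+ 2 + w + 1 != 0).
Proof.
have two0 : 2%:R = 0 :> F by rewrite pcharf0 // pchar2_card.
split=> [odd_n w | no_root].
  apply/eqP=> w0.
  have w3 : w ^+ 3 = 1.
    have: w ^+ 3 - 1 = (w - 1) * (w ^+ 2 + w + 1) by ring.
    by rewrite w0 mulr0 => /eqP; rewrite subr_eq0 => /eqP.
  have w2 : w ^+ 2 = w.
    rewrite -[RHS](expf_card w) cardF (divn_eq (2 ^ n) 3) modn3_exp2 odd_n.
    by rewrite exprD mulnC exprM w3 expr1n mul1r.
  have /eqP : w + w + 1 = 0 by rewrite -{1}w2.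
  by rewrite -mulr2n -mulr_natl two0 mul0r add0r oner_eq0.
apply: contraT => even_n.
have F_gt1 : (1 < #|F|)%N := finNzRing_gt1 F.
have [m mE] : exists m, #|F| = (3 * m).+1.
  exists (#|F| %/ 3)%N; rewrite {1}(divn_eq #|F| 3) {2}cardF modn3_exp2.
  by rewrite (negPf even_n) addn1 mulnC.
have m_gt0 : (0 < m)%N by move: F_gt1; rewrite mE; case: (m).
have unity (x : F) : x != 0 -> m.-unity_root x.
  move=> xN0; apply/unity_rootP/eqP; rewrite -subr_eq0.
  have x3 : (x ^+ m) ^+ 3 = 1.
    by apply: (mulfI xN0); rewrite -exprM mulnC -exprS -mE expf_card mulr1.
  have : (x ^+ m) ^+ 3 - 1 = (x ^+ m - 1) * ((x ^+ m) ^+ 2 + x ^+ m + 1) by ring.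
  by rewrite x3 subrr => /esym/eqP; rewrite mulf_eq0 (negPf (no_root _)) orbF.
have := @max_unity_roots F m (enum (predC1 0)) m_gt0.
rewrite enum_uniq -cardE; move/(_ _ isT).
have -> : #|predC1 (0 : F)| = (3 * m)%N by rewrite cardC1 mE.
have -> : all m.-unity_root (enum (predC1 (0 : F))).
  by apply/allP=> x; rewrite mem_enum => /unity.
by move/(_ isT); rewrite leqNgt mulSn -[X in (X < _)%N]addn0 ltn_add2l muln_gt0 m_gt0.
Qed.

End FieldOrder.

Theorem theorem3p11 (F : finFieldType) (n : nat) (hq : #|F| = (2 ^ n)%N) :
  ((exists C : {set {set 'rV[F]_5}}, nonlinear_clique C /\ #|C| = 5%N)
     <-> odd n) /\
  (odd n -> forall C : {set {set 'rV[F]_5}},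
      nonlinear_clique C -> #|C| = 5%N ->
      exists D : {set {set 'rV[F]_5}}, cliqueG D /\ #|D| = 6%N /\ C \subset D) /\
  (forall (k : nat) (C : {set {set 'rV[F]_5}}),
      nonlinear_clique C -> #|C| = k -> ~ (6 < k)%N).
Proof.
have char2 := pchar2_card hq.
(* The base ovoid accounts for one vertex, so 5-cliques and 6-cliques come from frames of 4 and 5
   vectors. *)
have nonlin (C : {set {set 'rV[F]_5}}) : nonlinear_clique C -> (0 < #|C|)%N ->
    exists a D, [/\ frame a D, C = frame_clique a D & #|C| = #|D|.+1].
  move=> nlC; rewrite card_gt0 => C_n0.
  have [a [D [fD ->]]] := nonlinear_frame char2 nlC C_n0.
  by exists a, D; rewrite card_frame_clique.
split; [split | split] => [[C [nlC cC]] | odd_n | _ C nlC cC | k C nlC <- k_gt6].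
- have [|a [D [fD _]]] := nonlin C nlC; rewrite cC // => -[cD].
  have [|d1 [d2 [d3 [d4 [_ _ [t1 t2 t3 t4] [b12 b13 b14] [b23 b24 b34]]]]]] := frame4 fD.
    by rewrite -cD.
  have [ell_a _ _] := fD.
  by apply/(cube_root_of_unityP hq);
    apply: (no_cube_root_of_unity char2 ell_a t1 t2 t3 t4).
- have [a [D [fD cD]]] := frame_example char2 (proj1 (cube_root_of_unityP hq) odd_n).
  exists (frame_clique a D); rewrite card_frame_clique // cD; split=> //.
  have [|d1 [d2 [d3 [d4 [sub u4 _ _ _]]]]] := frame4 fD; first by rewrite cD.
  apply: (@frame_nonlinear _ char2 _ _ d1 d2) => //;
    try by apply: sub; rewrite !inE eqxx ?orbT.
  by move: u4; rewrite /= !inE !negb_or => /andP[/and3P[]].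
- have [|a [D [fD CE]]] := nonlin C nlC; rewrite cC // => -[cD].
  have [D' fD' [sDD' cD']] := frame_extend char2 fD (esym cD).
  exists (frame_clique a D'); split; first exact: frame_cliqueG.
  by rewrite card_frame_clique // cD' CE; split=> //; apply/imsetS/setUS.
have [|a [D [fD _ cD]]] := nonlin C nlC; first exact: ltn_trans k_gt6.
by have := card_frame char2 fD; rewrite leqNgt -ltnS -cD k_gt6.
Qed.
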